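(* Let $\mathbb S$ be the Sorgenfrey line. Then $(B_1(\mathbb S),\tau_{UC})$ is of the first Baire category in itself, i.e. it is a countable union of nowhere dense subsets of itself.
   Context: The Sorgenfrey line $\mathbb S$ is the real line with the topology generated by half-open intervals (the lower limit topology). $B_1(\mathbb S)$ is the set of all functions $f:\mathbb S\to\mathbb R$ that are pointwise limits of a sequence of continuous functions from $\mathbb S$ to $\mathbb R$ (where the target $\mathbb R$ has its usual topology). $\tau_{UC}$ is the topology of uniform convergence on compact sets: a base of neighbourhoods of $f$ is given by the sets $W(f,K,\varepsilon)=\{g:\ |f(x)-g(x)|<\varepsilon \text{ for all } x\in K\}$, where $K\subset \mathbb S$ is nonempty compact and $\varepsilon>0$. *)

(* Defs.v *)
From HB Require Import structures.
From mathcomp Require Import all_boot all_order all_algebra.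
From mathcomp Require Import all_classical all_reals topology normedtype.

Set Implicit Arguments.
Unset Strict Implicit.
Unset Printing Implicit Defensive.

Import Order.TTheory GRing.Theory Num.Theory.
Import numFieldNormedType.Exports.

Local Open Scope classical_set_scope.
Local Open Scope ring_scope.

(* An alias of R: it carries the lower limit topology instead of the usual
   topology that R itself has in the library. *)
Definition sorgenfrey (R : realType) : Type := R.

Section sorgenfrey.
Variable R : realType.

Definition sorgenfrey_base (ab : R * R) : set (sorgenfrey R) :=
  [set x : R | ab.1 <= x < ab.2].

Let base_cover : \bigcup_(ab in [set: R * R]) sorgenfrey_base ab = setT.
Proof.
rewrite -subTset => x _; exists (x, (x : R) + 1) => //=.
by rewrite /sorgenfrey_base /= lexx ltrDl ltr01.
Qed.

Let base_join (i j : R * R) (t : sorgenfrey R) :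
  [set: R * R] i -> [set: R * R] j ->
  sorgenfrey_base i t -> sorgenfrey_base j t ->
  exists k, [/\ [set: R * R] k, sorgenfrey_base k t &
    sorgenfrey_base k `<=` sorgenfrey_base i `&` sorgenfrey_base j].
Proof.
move: i j => [a b] [c d] _ _ /andP[/= at_ tb] /andP[/= ct td].
exists (Num.max a c, Num.min b d); split => //.
  by apply/andP; rewrite /= ge_max at_ ct lt_min tb td.
move=> x /andP[/=]; rewrite ge_max lt_min => /andP[ax cx] /andP[xb xd].
by split; apply/andP.
Qed.

HB.instance Definition _ := Choice.copy (sorgenfrey R) R.
HB.instance Definition _ :=
  isBaseTopological.Build (sorgenfrey R) base_cover base_join.

Lemma nbhs_sorgenfreyP (x : sorgenfrey R) (A : set (sorgenfrey R)) :
  nbhs x A <->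
  exists2 e : R, 0 < e & [set y : R | (x : R) <= y < (x : R) + e] `<=` A.
Proof.
rewrite nbhsE; split=> [[B [[D _ <-] [[a b] Dab /andP[/= ax xb]] BA]]|[e e0 xeA]].
  exists (b - (x : R)); first by rewrite subr_gt0.
  move=> y /= /andP[xy]; rewrite addrC subrK => yb; apply: BA.
  by exists (a, b) => //; apply/andP; rewrite (le_trans ax xy).
exists (sorgenfrey_base ((x : R), (x : R) + e)).
  split; last by rewrite /sorgenfrey_base /= lexx ltrDl.
  by exists [set ((x : R), (x : R) + e)] => //; rewrite bigcup_set1.
by move=> y xy; apply: xeA.
Qed.

End sorgenfrey.

Definition baire_one (X Y : topologicalType) : set (X -> Y) :=
  [set f | exists2 u : nat -> X -> Y, forall n, continuous (u n) &
    forall x, u n x @[n --> \oo] --> f x].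
Arguments baire_one : clear implicits.

Definition nowhere_dense (T : topologicalType) (A : set T) :=
  interior (closure A) = set0.

Definition first_category (T : topologicalType) (A : set T) :=
  exists2 F : nat -> set T, forall n, nowhere_dense (F n) & A = \bigcup_n F n.

(* The coercion of a set to a type endows it with the subspace topology. *)
Definition B1_UC (R : realType) : topologicalType :=
  (baire_one (sorgenfrey R) R : set {family compact, sorgenfrey R -> R}).

Lemma nbhs_family_compactP (X : topologicalType) (R : realType)
    (f : {family compact, X -> R}) (P : set {family compact, X -> R}) :
  nbhs f P <-> exists K : set X, exists e : R,
    [/\ compact K, 0 < e & [set g | forall x, K x -> `|f x - g x| < e] `<=` P].
Proof.
split; last first.
  move=> [K [e [cK e0 KeP]]]; apply: filterS KeP _.
  have := @fam_nbhs X R compact K [set xy : R * R | ball xy.1 e xy.2] f.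
  by apply => //; rewrite -entourage_ballE; exists e.
pose W (Ke : set X * R) := [set g : {family compact, X -> R} |
  forall x, Ke.1 x -> `|f x - g x| < Ke.2].
pose D := [set Ke : set X * R | compact Ke.1 /\ 0 < Ke.2].
have FW : Filter (filter_from D W).
  apply: filter_from_filter.
    by exists (set0, 1); split => //=; exact: compact0.
  move=> [K d] [L e] [/= cK d0] [/= cL e0].
  exists (K `|` L, Num.min d e).
    by split; rewrite /= ?lt_min ?d0//; exact: compactU.
  move=> g fg; split => x /= Kx; have /= := fg x.
    by move=> /(_ (or_introl Kx)); rewrite lt_min => /andP[].
  by move=> /(_ (or_intror Kx)); rewrite lt_min => /andP[].
suff FWf : {family compact, filter_from D W --> f}.
  by move=> /FWf [[K e] [cK e0] KeP]; exists K, e.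
apply/fam_cvgP => K cK Q /uniform_nbhs[E [+ EQ]].
rewrite -entourage_ballE => -[e /= e0 eE].
by exists (K, e) => // g fg; apply: EQ => x Kx; apply: eE; exact: fg.
Qed.

(* Main.v *)
Require Import Defs.
From mathcomp Require Import all_boot all_order all_algebra.
From mathcomp Require Import all_classical all_reals topology normedtype.
From mathcomp Require Import interval_inference sequences.

(** A function of the first Baire class on the Sorgenfrey line is bounded on
    some nonempty interval [p, q[: the sets where all the approximating
    continuous functions are bounded by n are closed and cover the line, so by
    Baire's theorem one of them contains such an interval
    ([baire_one_bounded]).  Taking p and q rational and the bound n integer,
    B_1 is thus a countable union of sets of functions bounded by n on [p, q[.

    Each of these sets is nowhere dense ([nowhere_dense_bounded]).  A
    basic neighbourhood only controls functions on a compact set K, and a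
    compact set of the Sorgenfrey line contains no interval [p, q[
    ([compact_sorgenfrey_nitv]).  At a point of [p, q[ outside K the value of a
    function can be changed to n + 1 without leaving the neighbourhood nor B_1
    ([baire_one_set_point]), and since points are compact, a whole
    neighbourhood of the modified function avoids the set. *)

Import Order.TTheory GRing.Theory Num.Theory.
Import numFieldNormedType.Exports.

Local Open Scope classical_set_scope.
Local Open Scope ring_scope.

Lemma first_category_bigcup (T : topologicalType) (I : countType) (D : set I)
    (A : I -> set T) :
  (forall i, D i -> nowhere_dense (A i)) ->
  first_category (\bigcup_(i in D) A i).
Proof.
move=> ndA; exists (fun n => if unpickle n is Some i then
    [set x | D i /\ A i x] else set0) => [n|].
  case: (unpickle n) => [i|]; last by rewrite /nowhere_dense closure0 interior0.
  have [Di|nDi] := pselect (D i).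
    rewrite (_ : [set x | _] = A i); first exact: ndA.
    by apply/seteqP; split=> [x []|x].
  rewrite (_ : [set x | _] = set0).
    by rewrite /nowhere_dense closure0 interior0.
  by rewrite -subset0 => x [].
apply/seteqP; split=> [x [i Di Aix]|x [n _]].
  by exists (pickle i) => //; rewrite pickleK.
by case: (unpickle n) => // i [Di Aix]; exists i.
Qed.

Lemma nbhs_B1_UCP (R : realType) (f : B1_UC R) (P : set (B1_UC R)) :
  nbhs f P <-> exists K : set (sorgenfrey R), exists e : R,
    [/\ compact K, 0 < e &
      forall g : B1_UC R,
        (forall x, K x -> `|\val f x - \val g x| < e) -> P g].
Proof.
split=> [|[K [e [cK e0 KeP]]]].
  rewrite nbhsE => -[_ [[V oV <-] Vf] VP].
  have /nbhs_family_compactP[K [e [cK e0 KeV]]] : nbhs (\val f) V.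
    by apply: open_nbhs_nbhs; split.
  by exists K, e; split=> // g /KeV /VP.
apply: (@filterS _ (nbhs f) _
    (\val @^-1` [set g | forall x, K x -> `|\val f x - g x| < e])).
  by move=> g; exact: KeP.
apply: (@initial_continuous (B1_UC R)
  {family compact, sorgenfrey R -> R} set_val f).
by apply/nbhs_family_compactP; exists K, e; split.
Qed.

(** Baire's theorem transfers from the usual topology: a Sorgenfrey-open set
    contains, next to each of its points x, some ]x, x + e[, so the usual
    interior of a Sorgenfrey-dense Sorgenfrey-open set is still dense. *)
Lemma sorgenfrey_Baire (R : realType) (E : nat -> set (sorgenfrey R)) :
  (forall n, closed (E n)) -> \bigcup_n E n = setT ->
  exists n, exists p : rat, exists q : rat,
    p < q /\ [set x : R | ratr p <= x < ratr q] `<=` E n.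
Proof.
move=> cE Ecover; apply: contrapT => noint.
pose G n : set R := interior (~` E n : set R).
have dG n : open (G n) /\ dense (G n).
  split; first exact: open_interior.
  move=> O [a Oa] oO.
  have /nbhs_ballP[r /= r0 arO] : nbhs a O by apply: open_nbhs_nbhs.
  have /rat_in_itvoo[p] : a - r < a by rewrite ltrBlDr ltrDl.
  rewrite in_itv/= => /andP[rp pa].
  have /rat_in_itvoo[q] : a < a + r by rewrite ltrDl.
  rewrite in_itv/= => /andP[aq qr].
  have [x [/andP[px xq] nEx]] : exists x : R, ratr p <= x < ratr q /\ ~ E n x.
    apply: contrapT => allE; apply: noint; exists n, p, q; split.
      by rewrite -(ltr_rat R); exact: lt_trans aq.
    move=> x pxq; apply: contrapT => nEx; apply: allE; by exists x.
  have /nbhs_sorgenfreyP[e e0 xeE] : nbhs (x : sorgenfrey R) (~` E n).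
    by apply: open_nbhs_nbhs; split => //; rewrite openC.
  have xm : x < Num.min (x + e) (ratr q) by rewrite lt_min xq ltrDl e0.
  have [y /andP[xy ym]] : exists y : R, x < y < Num.min (x + e) (ratr q).
    by exists ((x + Num.min (x + e) (ratr q)) / 2); rewrite !midf_lt.
  move: (ym); rewrite lt_min => /andP[yxe yq].
  exists y; split.
    apply: arO; rewrite /ball/= ltr_distlC.
    by rewrite (lt_trans rp (le_lt_trans px xy)) (lt_trans yq qr).
  have : nbhs y [set z : R | x < z < x + e].
    rewrite (_ : [set z | _] = `]x, x + e[%classic); last first.
      by apply/seteqP; split=> z /=; rewrite in_itv.
    by apply: open_nbhs_nbhs; split=> //=; rewrite in_itv/= xy.
  apply: filterS => z /andP[xz zxe]; apply: xeE; by rewrite /= (ltW xz).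
have [z [_ Gz]] := @Baire R R G dG setT (ex_intro _ 0 I) openT.
have : (\bigcup_n E n) z by rewrite Ecover.
by case=> n _ Enz; exact: (interior_subset (Gz n I)).
Qed.

(** The approximating sequence converges, hence is bounded, at every point;
    Baire's theorem makes the bound uniform on an interval, and it passes to
    the limit. *)
Lemma baire_one_bounded (R : realType) (f : sorgenfrey R -> R) :
  baire_one (sorgenfrey R) R f ->
  exists n : nat, exists p : rat, exists q : rat, p < q /\
    forall x : R, ratr p <= x < ratr q -> `|f x| <= n%:R.
Proof.
move=> [u cu uf].
pose D n : set R := [set y | `|y| <= n%:R].
have cD n : closed (D n).
  by have /continuous_closedP/(_ _ (@closed_le R n%:R)) := @norm_continuous R R.
pose E n := \bigcap_k (u k @^-1` D n).
have cE n : closed (E n).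
  apply: closed_bigI => k _.
  by have /continuous_closedP/(_ _ (cD n)) := cu k.
have Ecover : \bigcup_n E n = setT.
  rewrite -subTset => x _.
  have /cvg_seq_bounded/pinfty_ex_gt0[M M0 /= uM] : cvgn (u ^~ x).
    by apply/cvg_ex; exists (f x); exact: uf.
  exists (Num.truncn M).+1 => // k _; rewrite /D /=.
  by rewrite (le_trans (uM k I))// ltW// truncnS_gt.
have [n [p [q [pq Epq]]]] := @sorgenfrey_Baire R E cE Ecover.
exists n, p, q; split=> // x /Epq Ex.
apply: (closed_cvg (D n) (cD n) _ _ (uf x)).
by apply: nearW => k; exact: Ex.
Qed.

(** Points increasing to q have no cluster point in the Sorgenfrey line: c < q
    has the neighbourhood [c, (c + q) / 2[, and c >= q has [c, c + 1[. *)
Lemma compact_sorgenfrey_nitv (R : realType) (K : set (sorgenfrey R)) (p q : R) :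
  compact K -> p < q -> exists2 x : R, p <= x < q & ~ K x.
Proof.
move=> cK pq; apply: contrapT => pqK.
have Kq : (q^'-) K.
  near=> x; apply: contrapT => nKx; apply: pqK; exists x => //.
  by apply/andP; split; near: x; [exact: nbhs_left_ge|exact: nbhs_left_lt].
have [c [_ clc]] := cK _ (at_left_proper_filter q) Kq.
have [cq|qc] := ltP (c : R) q.
  have mq : ((c : R) + q) / 2 < q by rewrite midf_lt.
  have cm : (c : R) < ((c : R) + q) / 2 by rewrite midf_lt.
  have /clc : (q^'-) [set x : R | ((c : R) + q) / 2 < x] by exact: nbhs_left_gt.
  case/(_ [set x : R | (c : R) <= x < ((c : R) + q) / 2]) => [|x [/= mx]].
    apply/nbhs_sorgenfreyP; exists (((c : R) + q) / 2 - (c : R)).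
      by rewrite subr_gt0.
    by rewrite subrKC.
  by move=> /andP[_ /(lt_trans mx)]; rewrite ltxx.
have /clc : (q^'-) [set x : R | x < q] by exact: nbhs_left_lt.
case/(_ [set x : R | (c : R) <= x]) => [|x [/= xq]].
  by apply/nbhs_sorgenfreyP; exists 1 => // x /andP[].
by move=> /(le_trans qc); rewrite leNgt xq.
Unshelve. all: by end_near. Qed.

(** The intervals [a, b[ are clopen in the Sorgenfrey line. *)
Lemma near_sorgenfrey_itvco (R : realType) (a b : R) (x : sorgenfrey R) :
  \forall y \near x, (a <= (y : R) < b) = (a <= (x : R) < b).
Proof.
apply/nbhs_sorgenfreyP.
have [xa|ax] := ltP (x : R) a.
  exists (a - (x : R)); first by rewrite subr_gt0.
  by move=> y /= /andP[xy]; rewrite subrKC leNgt => ->.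
have [xb|bx] := ltP (x : R) b.
  exists (b - (x : R)); first by rewrite subr_gt0.
  by move=> y /= /andP[xy]; rewrite subrKC (le_trans ax xy) => ->.
exists 1 => // y /= /andP[xy _].
by rewrite [_ < b]ltNge (le_trans bx xy) andbF.
Qed.

Lemma continuous_sorgenfrey_patch (R : realType) (T : topologicalType) (a b : R)
    (f g : sorgenfrey R -> T) : continuous f -> continuous g ->
  continuous (fun x : sorgenfrey R => if a <= (x : R) < b then f x else g x).
Proof.
move=> cf cg x; have xab := near_sorgenfrey_itvco R a b x.
have Fx := @nbhs_filter (sorgenfrey R) x.
rewrite /prop_for /continuous_at /=; case: ifPn => abx.
  apply: (cvg_trans _ (cf x)); apply: (@near_eq_cvg _ _ _ Fx).
  by apply: (@filterS _ _ Fx _ _ _ xab) => y ->; rewrite abx.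
apply: (cvg_trans _ (cg x)); apply: (@near_eq_cvg _ _ _ Fx).
by apply: (@filterS _ _ Fx _ _ _ xab) => y ->; rewrite (negbTE abx).
Qed.

(** The intervals [a, a + 1/n[ are clopen and shrink to the point a, so the
    approximating sequence can be replaced by the constant c on them: this
    changes the limit at a only. *)
Lemma baire_one_set_point (R : realType) (f : sorgenfrey R -> R) (a c : R) :
  baire_one (sorgenfrey R) R f ->
  exists2 g, baire_one (sorgenfrey R) R g &
    g a = c /\ forall x, x <> a -> g x = f x.
Proof.
move=> [u cu uf].
exists (fun x => if x == a then c else f x); last first.
  by split=> [|x /eqP/negbTE ->]; rewrite ?eqxx.
exists (fun n x => if a <= (x : R) < a + n.+1%:R^-1 then c else u n x) => [n|x].
  by apply: continuous_sorgenfrey_patch => //; exact: cst_continuous.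
have [->|xa] := eqVneq x a.
  rewrite (_ : (fun n : nat => _) = cst c); first exact: cvg_cst.
  by apply/funext => n; rewrite lexx ltrDl invr_gt0 ltr0n.
apply: cvg_trans (uf x); apply: near_eq_cvg.
have [ltxa|ltax|eqxa] := ltgtP (x : R) a; last by rewrite eqxa eqxx in xa.
  by exact: nearW.
have xa0 : 0 < (x : R) - a by rewrite subr_gt0.
apply: filterS (near_infty_natSinv_lt (PosNum xa0)) => n /= nxa.
by rewrite ltNge -lerBrDl (ltW nxa).
Qed.

Lemma nowhere_dense_bounded (R : realType) (p q M : R) : p < q ->
  nowhere_dense
    [set f : B1_UC R | forall x : R, p <= x < q -> `|\val f x| <= M].
Proof.
move=> pq; rewrite /nowhere_dense -subset0 => f.
rewrite /interior/= => /nbhs_B1_UCP[K [e [cK e0 KeP]]].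
have [a apq nKa] := @compact_sorgenfrey_nitv R K p q cK pq.
have [g B1g [ga gf]] := @baire_one_set_point R (\val f) a (M + 1) (set_valP f).
pose g' : B1_UC R := exist _ g (mem_set B1g).
have /KeP clg : forall x, K x -> `|\val f x - \val g' x| < e.
  by move=> x Kx /=; rewrite gf ?subrr ?normr0// => xa; rewrite xa in Kx.
(* Closeness to g' at a alone already contradicts the bound M at a. *)
have /clg[h [/= hM gh]] : nbhs g'
    [set h : B1_UC R | `|\val g' a - \val h a| < 1].
  apply/nbhs_B1_UCP; exists [set (a : sorgenfrey R)], 1; split => //.
    exact: compact_set1.
  by move=> h /(_ a erefl).
have := hM a apq; rewrite leNgt => /negP; apply.
apply: lt_le_trans (ler_norm _).
move: gh; rewrite /= ga ltr_distlC => /andP[+ _].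
by rewrite addrK.
Qed.

Theorem proposition3p11 (R : realType) : first_category [set: B1_UC R].
Proof.
pose A (i : rat * rat * nat) := [set f : B1_UC R |
  forall x : R, ratr i.1.1 <= x < ratr i.1.2 -> `|\val f x| <= i.2%:R].
have -> : [set: B1_UC R] = \bigcup_(i in [set i | i.1.1 < i.1.2]) A i.
  apply/esym; rewrite -subTset => f _.
  have [n [p [q [pq fn]]]] := @baire_one_bounded R _ (set_valP f).
  by exists (p, q, n).
apply: first_category_bigcup => -[[p q] n] /= pq.
by apply: nowhere_dense_bounded; rewrite ltr_rat.
Qed.
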